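(* Let $G$ be a connected graph whose boundary $\partial(G)$ equals its set of simplicial vertices. Then $pd_s(G)=|\partial(G)|$. In particular: (i) for any positive integer $n$, $pd_s(K_n)=n$; (ii) for any tree $T$ with $l(T)$ leaves, $pd_s(T)=l(T)$; (iii) for any connected block graph $G$ of order $n$ with $c$ cut vertices, $pd_s(G)=n-c$.
   Context: Graphs are finite, simple, connected; $d_G$ is shortest-path distance, $d_G(x,W)=\min\{d_G(x,w):w\in W\}$. A set $W$ strongly resolves different vertices $x,y\notin W$ if $d_G(x,W)=d_G(x,y)+d_G(y,W)$ or $d_G(y,W)=d_G(y,x)+d_G(x,W)$. A vertex partition $\Pi$ is a strong resolving partition if every two different vertices in the same set of $\Pi$ are strongly resolved by some set of $\Pi$; $pd_s(G)$ is the minimum cardinality of such a partition. A vertex $u$ is maximally distant from $v$ if $d_G(v,w)\le d_G(u,v)$ for every neighbor $w$ of $u$; $u,v$ are mutually maximally distant if each is maximally distant from the other. The boundary $\partial(G)$ is the set of vertices $u$ for which some $v$ exists with $u,v$ mutually maximally distant. A vertex is simplicial if its neighbors induce a complete graph. A block graph is a graph in which every block (biconnected component) is a clique.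
   Formalization: Part (ii) is stated for trees with at least two vertices: the one-vertex tree has no leaf (vertex of degree 1), while its strong partition dimension is 1 by part (i). *)

(* Defs.v *)
From mathcomp Require Import all_boot.

Set Implicit Arguments.
Unset Strict Implicit.
Unset Printing Implicit Defensive.

Record sgraph := SGraph {
  vertex :> finType;
  adj : rel vertex;
  adj_sym : symmetric adj;
  adj_irrefl : irreflexive adj
}.

Section Graph.
Variable G : sgraph.
Implicit Types (u v w x y : G) (S W B : {set G}) (Pi : {set {set G}}).

Definition nbhd u : {set G} := [set w | adj u w].

Definition induced_adj S : rel G :=
  [rel x y | [&& x \in S, y \in S & adj x y]].

(* The subgraph induced by S is connected; true of the empty set. *)
Definition connected_in S : bool :=
  [forall x in S, forall y in S, connect (induced_adj S) x y].

Definition connected_graph : bool := (0 < #|G|) && connected_in [set: G].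

Definition has_walk x y (k : nat) : bool :=
  [exists p : k.-tuple G, path (@adj G) x p && (last x p == y)].

(* The least length of a walk from x to y. Shortest walks have fewer than     *)
(* #|G| edges, so the search range is large enough; the value is #|G| when    *)
(* x and y lie in different components.                                       *)
Definition dist x y : nat := find (has_walk x y) (iota 0 #|G|).

(* In a connected graph dist x w < #|G|, so the neutral value #|G| is only    *)
(* attained when W is empty.                                                  *)
Definition set_dist x W : nat := \big[minn/#|G|]_(w in W) dist x w.

Definition strongly_resolves W x y : bool :=
  [&& x != y, x \notin W, y \notin W &
      (set_dist x W == dist x y + set_dist y W)
      || (set_dist y W == dist y x + set_dist x W)].

Definition strong_resolving_partition Pi : bool :=
  partition Pi [set: G] &&
  [forall B in Pi, forall x in B, forall y in B,
     (x != y) ==> [exists W in Pi, strongly_resolves W x y]].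

Definition singletons : {set {set G}} := [set [set x] | x : G].

Lemma strong_resolving_singletons : strong_resolving_partition singletons.
Proof.
apply/andP; split.
  apply/and3P; split.
  - apply/eqP/setP => x; rewrite inE; apply/bigcupP.
    by exists [set x]; [apply: imset_f | rewrite inE].
  - apply/trivIsetP => A B /imsetP[x _ ->] /imsetP[y _ ->] neq.
    by rewrite disjoints1 inE; apply: contra neq => /eqP->.
  - by apply/imsetP => -[x _ /setP/(_ x)]; rewrite !inE eqxx.
apply/forall_inP => B /imsetP[z _ ->].
apply/forall_inP => x /set1P->; apply/forall_inP => y /set1P->.
by rewrite eqxx.
Qed.

(* The default point of the arg min is admissible by the lemma above, so this *)
(* is the minimum of #|Pi| over all strong resolving partitions.              *)
Definition pds : nat :=
  #|[arg min_(Pi < singletons | strong_resolving_partition Pi) #|Pi|]|.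

Definition maximally_distant u v : bool :=
  [forall w in nbhd u, dist v w <= dist u v].

Definition mutually_maximally_distant u v : bool :=
  maximally_distant u v && maximally_distant v u.

(* v = u is not excluded; it is a witness only when u is an isolated vertex,  *)
(* which for connected graphs means the one-vertex graph.                     *)
Definition boundary : {set G} :=
  [set u | [exists v, mutually_maximally_distant u v]].

Definition clique S : bool :=
  [forall x in S, forall y in S, (x != y) ==> adj x y].

Definition simplicial_vertices : {set G} := [set u | clique (nbhd u)].

Definition leaves : {set G} := [set u | #|nbhd u| == 1].

(* A list [:: x; y] with x and y adjacent is already a ucycle, so only those  *)
(* of size at least 3 are graph cycles.                                       *)
Definition acyclic : Prop :=
  forall c : seq G, ucycle (@adj G) c -> size c <= 2.

Definition tree : Prop := connected_graph /\ acyclic.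

(* Cut vertices of a connected graph. *)
Definition cut_vertices : {set G} :=
  [set v | ~~ connected_in [set~ v]].

(* The subgraph induced by B is connected and has no cut vertex of its own;   *)
(* K_1 and K_2 qualify.                                                       *)
Definition nonseparable B : bool :=
  [&& B != set0, connected_in B & [forall v in B, connected_in (B :\ v)]].

(* Maximal nonseparable subgraphs are induced, hence given by vertex sets. *)
Definition block B : bool := maxset nonseparable B.

Definition block_graph : bool := [forall B : {set G}, block B ==> clique B].

End Graph.

Lemma complete_sym n : symmetric (fun x y : 'I_n => x != y).
Proof. by move=> x y; rewrite eq_sym. Qed.

Lemma complete_irrefl n : irreflexive (fun x y : 'I_n => x != y).
Proof. by move=> x; rewrite eqxx. Qed.

Definition complete_graph (n : nat) : sgraph :=
  SGraph (@complete_sym n) (@complete_irrefl n).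

(* Main.v *)
(* A geodesic between distinct vertices x, y extends, by maximality, to a      *)
(* geodesic between two mutually maximally distant vertices. Hence keeping     *)
(* one boundary vertex u0 together with all the non-boundary vertices, and     *)
(* isolating every other boundary vertex, is a strong resolving partition:     *)
(* one of the two ends of the extension differs from u0. Conversely a          *)
(* simplicial vertex is never interior to a geodesic, so two simplicial        *)
(* vertices are never strongly resolved and must lie in different sets. A      *)
(* boundary vertex is not a cut vertex, and two neighbors of a non-cut vertex  *)
(* lie on a common cycle with it; in a block graph such a cycle is contained   *)
(* in a clique, and in a tree there is none, so boundary vertices are          *)
(* simplicial there.                                                           *)
Require Import Defs.
From mathcomp Require Import all_boot zify.

Set Implicit Arguments.
Unset Strict Implicit.
Unset Printing Implicit Defensive.

(** Two bounds, each valid in every connected graph, meet under the hypothesis. [pds_le_boundary]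
    extends geodesics to mutually maximally distant pairs ([geodesic_extension]);
    [simplicial_leq_partition] says that the simplicial vertices lie in pairwise different sets of
    any strong resolving partition. For the special families, simplicial vertices are always in the
    boundary ([simplicial_sub_boundary]) and boundary vertices are never cut vertices
    ([boundary_not_cut]). So it suffices that every non-cut vertex is simplicial, which
    [non_cut_vertex_ucycle] yields for block graphs and trees; in a complete graph all vertices are
    simplicial. *)

Section ConnectedIn.
Variable G : sgraph.
Implicit Types (u v x y : G) (S : {set G}) (c p : seq G).

(** * Connectivity of induced subgraphs, and cycles *)

Lemma induced_connect_sym S : connect_sym (induced_adj S).
Proof.
apply: sym_connect_sym => x y /=.
by rewrite /induced_adj /= adj_sym andbCA.
Qed.

Lemma connected_inP S :
  reflect {in S &, forall x y, connect (induced_adj S) x y} (connected_in S).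
Proof.
apply: (iffP forall_inP) => [h x y xS yS | h x xS].
  by move/forall_inP: (h x xS); apply.
by apply/forall_inP => y yS; apply: h.
Qed.

Lemma cliqueP S :
  reflect {in S &, forall x y, x != y -> adj x y} (clique S).
Proof.
apply: (iffP forall_inP) => [h x y xS yS xy | h x xS].
  by move/forall_inP/(_ y yS): (h x xS); rewrite xy.
by apply/forall_inP => y yS; apply/implyP; apply: h.
Qed.

Lemma connected_in_root S r :
  {in S, forall y, connect (induced_adj S) r y} -> connected_in S.
Proof.
move=> h; apply/connected_inP => x y xS yS.
apply: connect_trans (h y yS).
by rewrite induced_connect_sym h.
Qed.

Lemma connected_in_path x p :
  path (@adj G) x p -> connected_in [set y in x :: p].
Proof.
move=> xp; apply: (@connected_in_root _ x) => y; rewrite inE => yp.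
apply: path_connect yp.
apply: (sub_in_path (P := mem (x :: p))) xp; last exact/allP.
by move=> a b; rewrite /induced_adj /= !inE => -> ->.
Qed.

(** Rotating a cycle so that it starts at the deleted vertex shows that the remaining vertices form
    a path. *)
Lemma ucycle_nonseparable c :
  0 < size c -> ucycle (@adj G) c -> nonseparable [set x in c].
Proof.
move=> c0 /andP[cyc uc]; apply/and3P; split.
- case: c c0 {cyc uc} => // x c _.
  by apply/set0Pn; exists x; rewrite !inE eqxx.
- case: c c0 cyc {uc} => // x c _ /=; rewrite rcons_path => /andP[xc _].
  exact: connected_in_path.
apply/forall_inP => v; rewrite inE => vc.
have [i q rc] := rot_to vc.
have : cycle (@adj G) (v :: q) by rewrite -rc rot_cycle.
have /= /andP[vq _] : uniq (v :: q) by rewrite -rc rot_uniq.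
have -> : [set x in c] :\ v = [set x in q].
  apply/setP => x; rewrite !inE -(mem_rot i) rc inE.
  by case: eqVneq => // ->; rewrite (negPf vq).
case: q {rc vq} => [_|y q].
  by apply/connected_inP => x y; rewrite inE.
by rewrite /= rcons_path => /and3P[_ yq _]; apply: connected_in_path.
Qed.

(** A simple path from [a] to [b] that avoids [u] closes up through [u]. *)
Lemma non_cut_vertex_ucycle u a b :
    u \notin cut_vertices G -> adj u a -> adj u b -> a != b ->
  exists2 c, ucycle (@adj G) c & [&& u \in c, a \in c & b \in c].
Proof.
rewrite inE negbK => /connected_inP conu ua ub ab.
have neq_u x : adj u x -> x \in [set~ u].
  by move=> ux; rewrite !inE; apply: contraTneq ux => ->; rewrite adj_irrefl.
have /connectP[p ap def_b] := conu a b (neq_u a ua) (neq_u b ub).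
case/shortenP: ap def_b => q aq uq _ def_b.
have uNq : u \notin a :: q.
  have := neq_u a ua; rewrite inE negb_or !inE eq_sym => -> /=.
  elim: q a aq {uq def_b ua ab} => //= z q IH a /andP[/and3P[_ zu _] zq].
  by rewrite negb_or (IH z zq) andbT; move: zu; rewrite !inE eq_sym.
exists (u :: a :: q).
  apply/andP; split; last by rewrite cons_uniq uNq uq.
  rewrite /= ua rcons_path -def_b adj_sym ub andbT.
  by apply: sub_path aq => x y /and3P[].
have bq : b \in a :: q by rewrite def_b mem_last.
by rewrite mem_head in_cons mem_head orbT in_cons bq orbT.
Qed.

End ConnectedIn.

(** * Distance to a set as a minimum *)

Section SetDist.
Variable G : sgraph.
Implicit Types (x w : G) (W : {set G}).

Lemma set_dist_le x w W : w \in W -> set_dist x W <= dist x w.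
Proof.
move=> wW; rewrite /set_dist -big_filter.
have : w \in [seq i <- index_enum G | i \in W].
  by rewrite mem_filter wW mem_index_enum.
elim: [seq _ <- _ | _] => //= a s IH; rewrite big_cons inE.
case/predU1P => [-> | /IH ws]; first exact: geq_minl.
exact: leq_trans (geq_minr _ _) ws.
Qed.

Lemma set_dist_attained x W :
  set_dist x W = #|G| \/ exists2 w, w \in W & set_dist x W = dist x w.
Proof.
rewrite /set_dist.
elim/big_ind: _ => [|m n hm hn|w wW]; [by left| |by right; exists w].
by case: (leqP m n) => _.
Qed.

End SetDist.

(** * The graph metric *)

Section Connected.
Variable G : sgraph.
Hypothesis conG : connected_graph G.
Implicit Types (u v w x y z : G) (W : {set G}) (Pi : {set {set G}}).

Lemma dist_le_size x p : path (@adj G) x p -> dist x (last x p) <= size p.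
Proof.
move=> xp; rewrite /dist; set s := iota _ _.
have [small|big] := ltnP (size p) #|G|; last first.
  (* A walk too long for the search range is no shorter than the default value [#|G|]. *)
  by apply: leq_trans (find_size _ _) _; rewrite size_iota.
rewrite leqNgt; apply/negP => /(before_find 0).
rewrite nth_iota // add0n => /existsP[].
by exists (in_tuple p); rewrite /= xp eqxx.
Qed.

Lemma geodesic x y :
  exists p, [/\ path (@adj G) x p, last x p = y & size p = dist x y].
Proof.
have /andP[_ /connected_inP/(_ x y)] := conG.
case/(_ (in_setT _) (in_setT _))/connectP => p xp ->{y}.
case/shortenP: xp => q xq uq _.
have {}xq : path (@adj G) x q.
  by apply: sub_path xq => a b /and3P[].
have hasw : has (has_walk x (last x q)) (iota 0 #|G|).
  apply/hasP; exists (size q).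
    rewrite mem_iota /= add0n -[_.+1]/(size (x :: q)) -(card_uniqP uq).
    exact: max_card.
  by apply/existsP; exists (in_tuple q); rewrite /= xq eqxx.
have := nth_find 0 hasw; rewrite nth_iota; last first.
  by rewrite -[ltnRHS](size_iota 0) -has_find.
case/existsP => r /andP[xr /eqP lr].
by exists r; rewrite size_tuple.
Qed.

(** A simple path has fewer than [#|G|] edges. Hence the default [#|G|] of [set_dist] never wins
    over a member of the set. *)
Lemma dist_lt x y : dist x y < #|G|.
Proof.
have /andP[_ /connected_inP/(_ x y)] := conG.
case/(_ (in_setT _) (in_setT _))/connectP => p xp ->{y}.
case/shortenP: xp => q xq uq _.
have {}xq : path (@adj G) x q.
  by apply: sub_path xq => a b /and3P[].
apply: leq_ltn_trans (dist_le_size xq) _.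
by rewrite -[_.+1]/(size (x :: q)) -(card_uniqP uq) max_card.
Qed.

Lemma distxx x : dist x x = 0.
Proof. by apply/eqP; rewrite -leqn0; apply: (@dist_le_size x [::]). Qed.

Lemma dist_eq0 x y : (dist x y == 0) = (x == y).
Proof.
apply/eqP/eqP => [d0|->]; last exact: distxx.
have [p [_ lp]] := geodesic x y.
by rewrite d0 -lp => /size0nil->.
Qed.

Lemma dist_adj x y : adj x y -> dist x y <= 1.
Proof. by move=> xy; apply: (@dist_le_size x [:: y]); rewrite /= xy. Qed.

Lemma dist_triangle y x z : dist x z <= dist x y + dist y z.
Proof.
have [p [xp lp <-]] := geodesic x y; have [q [yq <- <-]] := geodesic y z.
rewrite -size_cat -lp -last_cat; apply: dist_le_size.
by rewrite cat_path xp lp.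
Qed.

Lemma dist_sym x y : dist x y = dist y x.
Proof.
suff le (a b : G) : dist a b <= dist b a by apply/eqP; rewrite eqn_leq !le.
have [p [bp <- <-]] := geodesic b a.
have := @dist_le_size (last b p) (rev (belast b p)).
rewrite rev_path (eq_path (e' := @adj G)); last by move=> u v; apply: adj_sym.
move=> /(_ bp); rewrite size_rev size_belast.
by case: p {bp} => //= a' p; rewrite rev_cons last_rcons.
Qed.

Lemma geodesic_step x y :
  x != y -> exists2 z, adj x z & dist x y = (dist z y).+1.
Proof.
have [[|z p] [xp lp sp]] := geodesic x y => neq.
  by rewrite -lp /= eqxx in neq.
move: xp => /= /andP[xz zp]; exists z => //.
apply/eqP; rewrite eqn_leq; apply/andP; split.
  apply: leq_trans (dist_triangle z _ _) _.
  by rewrite -addn1 addnC leq_add2l dist_adj.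
by rewrite -sp ltnS -lp dist_le_size.
Qed.

(** * Lower bound by simplicial vertices *)

Lemma simplicial_not_between u x y :
    u \in simplicial_vertices G -> x != u -> y != u ->
  dist x y < dist x u + dist u y.
Proof.
(* The neighbors [a], [b] of [u] towards [y] and [x] are equal or adjacent, so skipping [u] saves at
   least one edge. *)
rewrite inE => /cliqueP cl xu yu.
have [a ua da] : exists2 a, adj u a & dist u y = (dist a y).+1.
  by apply: geodesic_step; rewrite eq_sym.
have [b ub db] : exists2 b, adj u b & dist u x = (dist b x).+1.
  by apply: geodesic_step; rewrite eq_sym.
have ba : dist b a <= 1.
  have [->|neq] := eqVneq b a; first by rewrite distxx.
  by apply: dist_adj; rewrite cl ?inE.
have := dist_triangle b x y; have := dist_triangle a b y.
by rewrite (dist_sym x u) da db (dist_sym x b); lia.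
Qed.

(** For [w] in [W] nearest to [y], equality would put the simplicial vertex [y] between [x] and
    [w]. *)
Lemma resolved_not_simplicial W x y :
    W != set0 -> x \notin W -> y \notin W -> x != y ->
    y \in simplicial_vertices G ->
  set_dist x W != dist x y + set_dist y W.
Proof.
case/set0Pn => w0 w0W xW yW xy simp; apply/eqP => e.
have [dflt|[w wW dw]] := set_dist_attained y W.
  have := leq_ltn_trans (set_dist_le y w0W) (dist_lt _ _).
  by rewrite dflt ltnn.
have wy : w != y by apply: contraNneq yW => <-.
have := leq_ltn_trans (set_dist_le x wW) (simplicial_not_between simp xy wy).
by rewrite e dw ltnn.
Qed.

Lemma simplicial_leq_partition Pi :
  strong_resolving_partition Pi -> #|simplicial_vertices G| <= #|Pi|.
Proof.
case/andP => /and3P[/eqP covPi trivPi Pi0] /forall_inP res.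
have inPi x : pblock Pi x \in Pi by rewrite pblock_mem // covPi.
have mem_block x : x \in pblock Pi x by rewrite mem_pblock covPi.
rewrite -(card_in_imset (f := pblock Pi)).
  by apply/subset_leq_card/subsetP => _ /imsetP[x _ ->].
move=> x y sx sy eqb; apply/eqP/negPn/negP => xy.
have /forall_inP/(_ x (mem_block x))/forall_inP/(_ y) := res _ (inPi x).
rewrite {1}eqb => /(_ (mem_block y)); rewrite xy.
case/exists_inP => W WPi /and4P[_ xW yW].
have W0 : W != set0 by apply: contraNneq Pi0 => <-.
rewrite (negPf (resolved_not_simplicial W0 xW yW xy sy)) /=.
by rewrite (negPf (resolved_not_simplicial W0 yW xW _ sx)) // eq_sym.
Qed.

(** * Upper bound by the boundary *)

Lemma geodesic_extension x y : exists u v,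
  mutually_maximally_distant u v /\ dist u v = dist u x + dist x y + dist y v.
Proof.
(* Among pairs with a geodesic running through [x] and then [y], take one at the largest distance: a
   neighbor of one end farther from the other end would give a longer such pair. *)
pose ext (e : G * G) :=
  dist e.1 e.2 == dist e.1 x + dist x y + dist y e.2.
have ext0 : ext (x, y) by rewrite /ext /= !distxx addn0.
case: (arg_maxnP (fun e => dist e.1 e.2) ext0) => -[u v] /eqP /= uv maxuv.
exists u, v; split=> //; apply/andP; split.
  apply/forall_inP => w; rewrite inE => /dist_adj uw.
  rewrite leqNgt; apply/negP => far.
  suff /maxuv : ext (w, v) by rewrite /= (dist_sym w v); lia.
  rewrite /ext /=; have := dist_triangle u w x; have := dist_triangle x w v.
  by have := dist_triangle y x v; rewrite (dist_sym w v) (dist_sym w u); lia.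
apply/forall_inP => w; rewrite inE => /dist_adj vw.
rewrite leqNgt; apply/negP => far.
rewrite (dist_sym v u) in far.
suff /maxuv : ext (u, w) by rewrite /=; lia.
rewrite /ext /=; have := dist_triangle v y w; have := dist_triangle y u w.
by have := dist_triangle x u y; lia.
Qed.

Lemma mutually_maximally_distant_sym u v :
  mutually_maximally_distant u v = mutually_maximally_distant v u.
Proof. exact: andbC. Qed.

Lemma boundary_neq0 : boundary G != set0.
Proof.
have /andP[/card_gt0P[x _] _] := conG.
have [u [v [uv _]]] := geodesic_extension x x.
by apply/set0Pn; exists u; rewrite inE; apply/existsP; exists v.
Qed.

Lemma set_dist1 x v : set_dist x [set v] = dist x v.
Proof.
have [e|[w /set1P-> //]] := set_dist_attained x [set v].
have := leq_ltn_trans (set_dist_le x (set11 v)) (dist_lt x v).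
by rewrite e ltnn.
Qed.

Lemma pds_le_boundary : pds G <= #|boundary G|.
Proof.
have /set0Pn[u0 u0B] := boundary_neq0.
pose D := boundary G :\ u0; pose Pi := ~: D |: [set [set v] | v in D].
have u0D : u0 \in ~: D by rewrite !inE eqxx.
have CD_notin : ~: D \notin [set [set v] | v in D].
  apply/imsetP => -[v vD e]; move: u0D; rewrite e => /set1P u0v.
  by rewrite -u0v !inE eqxx in vD.
have cardPi : #|Pi| = #|boundary G|.
  rewrite cardsU1 CD_notin card_imset; last exact: set1_inj.
  by rewrite [RHS](cardsD1 u0) u0B.
rewrite -cardPi /pds; case: arg_minnP => [|Q _]; last apply.
  exact: strong_resolving_singletons.
apply/andP; split.
  apply/and3P; split.
  - apply/eqP/setP => x; rewrite in_setT; apply/bigcupP.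
    have [xD|xD] := boolP (x \in D).
      by exists [set x]; rewrite ?set11 // !inE imset_f // orbT.
    by exists (~: D); rewrite ?setU11 ?in_setC.
  - apply/trivIsetP => A B.
    case/setU1P => [->|/imsetP[a aD ->]]; case/setU1P => [->|/imsetP[b bD ->]].
    + by rewrite eqxx.
    + by rewrite disjoint_sym disjoints1 inE bD.
    + by rewrite disjoints1 inE aD.
    + by rewrite disjoints1 inE; apply: contra => /eqP->.
  - apply/negP => /setU1P[e|/imsetP[v _ /setP/(_ v)]].
      by rewrite -e inE in u0D.
    by rewrite !inE eqxx.
apply/forall_inP => A APi; apply/forall_inP => x xA; apply/forall_inP => y yA.
apply/implyP => xy; case/setU1P: APi => [eA|/imsetP[v _ eA]]; last first.
  by move: xA yA xy; rewrite eA => /set1P-> /set1P->; rewrite eqxx.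
have [u [v [uv duv]]] := geodesic_extension x y.
have uB : u \in boundary G by rewrite inE; apply/existsP; exists v.
have vB : v \in boundary G.
  by rewrite inE; apply/existsP; exists u; rewrite mutually_maximally_distant_sym.
have notin z w : z \in A -> w \in D -> z \notin [set w].
  by rewrite eA => zD wD; apply: contraTN zD => /set1P->; rewrite inE wD.
have d0 : 0 < dist x y by rewrite lt0n dist_eq0.
(* Only [u0] lacks its own singleton. If [v] is [u0], then [u] is not, since [dist u v] is at least
   [dist x y], which is positive. *)
have [eu0|v_neq] := eqVneq v u0; last first.
  have vD : v \in D by rewrite in_setD1 v_neq.
  apply/exists_inP; exists [set v]; first by rewrite in_setU1 imset_f // orbT.
  rewrite /strongly_resolves xy !notin //= !set_dist1; apply/orP; left.
  have := dist_triangle y x v; have := dist_triangle x u v; lia.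
have uD : u \in D.
  rewrite in_setD1 uB andbT; apply: contraTneq d0 => eu.
  by move: duv; rewrite eu eu0 distxx; lia.
apply/exists_inP; exists [set u]; first by rewrite in_setU1 imset_f // orbT.
rewrite /strongly_resolves xy !notin //= !set_dist1; apply/orP; right.
have := dist_triangle x y u; have := dist_triangle y u v.
by rewrite !(dist_sym _ u) (dist_sym y x); lia.
Qed.

Lemma pds_simplicial_boundary :
  boundary G = simplicial_vertices G -> pds G = #|boundary G|.
Proof.
move=> e; apply/eqP; rewrite eqn_leq pds_le_boundary /= e /pds.
case: arg_minnP => [|Pi srPi _]; first exact: strong_resolving_singletons.
exact: simplicial_leq_partition.
Qed.

(** * Simplicial, boundary and cut vertices *)

Lemma simplicial_sub_boundary : simplicial_vertices G \subset boundary G.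
Proof.
apply/subsetP => u simp; rewrite inE.
(* A vertex [v] farthest from [u] is a witness: a neighbor of [u] farther from [v] than [u] would
   put [u] between it and [v]. *)
case: (arg_maxnP (P := xpredT) (dist u) (isT : xpredT u)) => v _ far.
apply/existsP; exists v; apply/andP; split; apply/forall_inP => w.
  rewrite inE => uw; rewrite leqNgt; apply/negP => lt.
  have [vu|vu] := eqVneq v u.
    by move: lt (far w); rewrite vu /= distxx; lia.
  have wu : w != u by apply: contraTneq uw => ->; rewrite adj_irrefl.
  have := simplicial_not_between simp vu wu.
  by rewrite (dist_sym v u); have := dist_adj uw; lia.
by move=> _; rewrite [leqRHS]dist_sym; apply: far.
Qed.

Lemma boundary_not_cut u : u \in boundary G -> u \notin cut_vertices G.
Proof.
rewrite !inE negbK => /existsP[v /andP[/forall_inP uv _]].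
(* If [u] is its own witness, it has no neighbor and the graph is a single vertex. *)
have [vu|vu] := eqVneq v u.
  apply/connected_inP => x y; rewrite !inE => xu _.
  have [z uz _] : exists2 z, adj u z & dist u x = (dist z x).+1.
    by apply: geodesic_step; rewrite eq_sym.
  have := uv z; rewrite inE uz vu distxx leqn0 dist_eq0 => /(_ isT)/eqP uz'.
  by rewrite -uz' adj_irrefl in uz.
apply: (@connected_in_root _ _ v) => x; rewrite !inE.
(* A geodesic from [x] to [v] avoids [u]: entering [u] would come from a neighbor farther from [v]
   than [u] is. *)
have [n] := ubnP (dist x v); elim: n x => // n IH x.
rewrite ltnS => le_n xu; have [-> //|xv] := eqVneq x v.
have [z xz dxz] := geodesic_step xv.
have zu : z != u.
  apply/eqP => zu; move: xz dxz; rewrite zu => xu_adj.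
  by have := uv x; rewrite inE adj_sym xu_adj (dist_sym v x) => /(_ isT); lia.
apply: connect_trans (IH z _ zu) (connect1 _); first by rewrite -dxz.
by rewrite /induced_adj /= !inE zu xu adj_sym.
Qed.

Lemma boundary_simplicial_of_not_cut :
    {subset ~: cut_vertices G <= simplicial_vertices G} ->
  boundary G = simplicial_vertices G /\ boundary G = ~: cut_vertices G.
Proof.
move=> sub.
have BC : boundary G \subset ~: cut_vertices G.
  by apply/subsetP => u /boundary_not_cut; rewrite !inE.
have CS : ~: cut_vertices G \subset simplicial_vertices G by apply/subsetP.
have SB := simplicial_sub_boundary.
split; apply/eqP; rewrite eqEsubset.
  by rewrite (subset_trans BC CS).
by rewrite BC (subset_trans CS SB).
Qed.

End Connected.

(** * Block graphs, trees and complete graphs *)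

Lemma block_graph_not_cut_simplicial (G : sgraph) :
  block_graph G -> {subset ~: cut_vertices G <= simplicial_vertices G}.
Proof.
move=> /forallP bG u; rewrite in_setC => uNcut.
rewrite inE; apply/cliqueP => a b; rewrite !inE => ua ub ab.
have [c cyc /and3P[_ ac bc]] := non_cut_vertex_ucycle uNcut ua ub ab.
have [|B maxB /subsetP cB] := @maxset_exists _ (@nonseparable G) [set x in c].
  by apply: ucycle_nonseparable cyc; case: c ac {bc}.
have /implyP/(_ maxB)/cliqueP := bG B.
by apply; rewrite ?cB ?inE.
Qed.

(** Two distinct neighbors of a non-cut vertex would lie with it on a cycle of at least three
    vertices, so there is at most one neighbor. *)
Lemma tree_not_cut_simplicial (T : sgraph) :
  tree T -> {subset ~: cut_vertices T <= simplicial_vertices T}.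
Proof.
move=> [_ acT] u; rewrite in_setC => uNcut.
rewrite inE; apply/cliqueP => a b; rewrite !inE => ua ub ab.
have [c cyc /and3P[uc ac bc]] := non_cut_vertex_ucycle uNcut ua ub ab.
have : 2 < size c.
  apply: (@uniq_leq_size _ [:: u; a; b]).
    rewrite /= !inE ab negb_or !andbT.
    by apply/andP; split; [apply: contraTneq ua | apply: contraTneq ub] => <-;
      rewrite adj_irrefl.
  by move=> x; rewrite !inE => /or3P[] /eqP->.
by rewrite ltnNge acT.
Qed.

Lemma tree_simplicial_leaves (T : sgraph) :
  tree T -> 1 < #|T| -> simplicial_vertices T = leaves T.
Proof.
move=> [conT acT] T1; apply/setP => u; rewrite !inE; apply/idP/cards1P => [cl|].
  (* A second vertex gives [u] a neighbor; two neighbors of a simplicial vertex would close a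
     triangle. *)
  have [x xu] : exists x, u != x.
    have /card_gt1P[x [y [_ _ xy]]] := T1.
    by have [eq|] := eqVneq u x; [exists y; rewrite eq | exists x].
  have [a ua _] := geodesic_step conT xu.
  exists a; apply/setP => b; rewrite !inE; apply/idP/eqP => [ub|-> //].
  apply/eqP/negPn/negP => ba.
  have adj_ba : adj b a by move/cliqueP: cl; apply; rewrite ?inE.
  suff /acT : ucycle (@adj T) [:: u; b; a] by [].
  rewrite /ucycle /= ub adj_ba adj_sym ua /= !inE ba negb_or !andbT.
  by apply/andP; split; [apply: contraTneq ub | apply: contraTneq ua] => <-;
    rewrite adj_irrefl.
case=> a ->; apply/cliqueP => x y /set1P-> /set1P->.
by rewrite eqxx.
Qed.

Lemma complete_graph_connected n : 0 < n -> connected_graph (complete_graph n).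
Proof.
move=> n0; apply/andP; split; first by rewrite card_ord.
apply/connected_inP => x y _ _; have [-> //|xy] := eqVneq x y.
by apply: connect1; rewrite /induced_adj /= !inE.
Qed.

Lemma complete_graph_simplicial n : simplicial_vertices (complete_graph n) = setT.
Proof.
by apply/setP => u; rewrite !inE; apply/cliqueP.
Qed.

Theorem theorem12 :
  (forall G : sgraph, connected_graph G ->
     boundary G = simplicial_vertices G -> pds G = #|boundary G|)
  /\ (forall n : nat, 0 < n -> pds (complete_graph n) = n)
  /\ (forall T : sgraph, tree T -> 1 < #|T| -> pds T = #|leaves T|)
  /\ (forall G : sgraph, connected_graph G -> block_graph G ->
        pds G = #|G| - #|cut_vertices G|).
Proof.
split; first exact: pds_simplicial_boundary.
split.
  move=> n /complete_graph_connected conK.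
  have BS : boundary (complete_graph n) = simplicial_vertices _.
    apply/eqP; rewrite eqEsubset simplicial_sub_boundary // andbT.
    by rewrite complete_graph_simplicial subsetT.
  by rewrite pds_simplicial_boundary // BS complete_graph_simplicial cardsT card_ord.
split=> [T treeT T1|G conG blockG].
  have [conT _] := treeT.
  have [BS _] :=
    boundary_simplicial_of_not_cut conT (tree_not_cut_simplicial treeT).
  by rewrite pds_simplicial_boundary // BS tree_simplicial_leaves.
have [BS BC] :=
  boundary_simplicial_of_not_cut conG (block_graph_not_cut_simplicial blockG).
by rewrite pds_simplicial_boundary // BC cardsCs setCK.
Qed.
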